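(* Let $f$ be a $C^1$ symplectic twist diffeomorphism of $\mathbb A=\mathbb T\times\mathbb R$ and let $u:\mathbb T\times\mathbb R\to\mathbb R$ be a continuous map such that $u(0,c)=0$ for all $c$ and each $u_c=u(\cdot,c)$ is a weak K.A.M. solution for the cohomology class $c$. Then: (1) $\displaystyle\bigcup_{c\in\mathbb R}\mathcal{PG}(c+u_c')=\mathbb A$; (2) if $c,c'\in\mathbb R$ are such that the rotation number associated to $c$ is strictly smaller than the one associated to $c'$, i.e. $\rho(c)<\rho(c')$, then for all $(q,p)\in\mathcal{PG}(c+u_c')$ and $(q,p')\in\mathcal{PG}(c'+u_{c'}')$ we have $p<p'$.
   Context: $\mathbb T=\mathbb R/\mathbb Z$, $\mathbb A=\mathbb T\times\mathbb R$ with coordinates $(\theta,r)$. Symplectic twist map (or diffeomorphism): a $C^1$ diffeomorphism $f:\mathbb A\to\mathbb A$ that is isotopic to the identity; exact symplectic, i.e. if $f(\theta,r)=(\Theta,R)$ then the 1-form $R\,d\Theta-r\,d\theta$ is exact; and has the twist property: for any lift $F=(F_1,F_2):\mathbb R^2\to\mathbb R^2$ of $f$ and any $\tilde\theta\in\mathbb R$, the map $r\mapsto F_1(\tilde\theta,r)$ is an increasing $C^1$ diffeomorphism from $\mathbb R$ onto $\mathbb R$. Generating function: fix a lift $F$ of $f$. A $C^2$ function $S:\mathbb R^2\to\mathbb R$ is a generating function of $F$ if $S(\theta+1,\Theta+1)=S(\theta,\Theta)$; $S(\theta,\Theta)/|\Theta-\theta|\to+\infty$ as $|\Theta-\theta|\to\infty$;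 for all $\theta_0,\Theta_0$ the maps $\theta\mapsto\frac{\partial S}{\partial\Theta}(\theta,\Theta_0)$ and $\Theta\mapsto\frac{\partial S}{\partial\theta}(\theta_0,\Theta)$ are decreasing diffeomorphisms of $\mathbb R$; and $F(\theta,r)=(\Theta,R)\Leftrightarrow r=-\frac{\partial S}{\partial\theta}(\theta,\Theta)$ and $R=\frac{\partial S}{\partial\Theta}(\theta,\Theta)$. Fix such an $S$. Weak K.A.M. solutions: for $c\in\mathbb R$ there is a unique $\alpha(c)\in\mathbb R$ for which there exists $u\in C^0(\mathbb T,\mathbb R)$ whose lift $\tilde u:\mathbb R\to\mathbb R$ satisfies, for all $\theta\in\mathbb R$, $\tilde u(\theta)=\inf_{\theta'\in\mathbb R}\big(\tilde u(\theta')+S(\theta',\theta)+c(\theta'-\theta)+\alpha(c)\big)$. Any such $u$ is a weak K.A.M. solution for the cohomology class $c$. Weak K.A.M. solutions are semi-concave, hence Lipschitz. Rotation number: the function $\alpha$ is convex and $C^1$; the rotation number associated to $c$ is $\rho(c)=\alpha'(c)$. (For every weak K.A.M. solution $u$ for the class $c$, it is the common rotation number of the $F$-orbits lifting orbits of the invariant compact set $\bigcap_{n\in\mathbb N}f^{-n}(\mathcal G(c+u'))$.) $\mathcal G(c+u')=\{(\theta,c+u'(\theta)):\ u \text{ differentiable at }\theta\}$. For a Lipschitz $g:\mathbb T\to\mathbb R$ and $x\in\mathbb T$, $\partial g(x)=\mathrm{co}\{(x,p)\in\mathbb T\times\mathbb R:(x,p)\in\overline{\mathcal G(g')}\}$,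 where co is the convex hull in the fiber direction, and $\mathcal{PG}(c+g')=\bigcup_{t\in\mathbb T}\big((0,c)+\partial g(t)\big)$ (the full pseudograph of $c+g'$). *)

(* Defs.v *)
From mathcomp Require Import all_boot all_order all_algebra.
From mathcomp Require Import all_classical all_reals all_analysis.

Set Implicit Arguments.
Unset Strict Implicit.
Unset Printing Implicit Defensive.

Import Order.TTheory GRing.Theory Num.Theory.
Import numFieldNormedType.Exports.

Local Open Scope classical_set_scope.
Local Open Scope ring_scope.

(** The circle R/Z and the annulus (R/Z) x R are handled through their universal
    covers R and R x R:
    - a function on the circle is a 1-periodic function on R; a function on the
      annulus is a function on R x R that is 1-periodic in the first variable;
    - a subset of the annulus is its (translation-invariant) preimage in R x R;
    - a map of the annulus isotopic to the identity is given by a lift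
      F : R x R -> R x R, which commutes with (theta, r) |-> (theta + 1, r). *)

Section smooth_maps.
Context {R : realType} {V W : normedModType R}.

(* In finite dimension, the continuity of x |-> 'D_v f x for every fixed v is
   the continuity of the differential. *)
Definition C1 (f : V -> W) : Prop :=
  (forall x, differentiable f x) /\ (forall v, continuous ('D_v f)).

Definition C2 (f : V -> W) : Prop := C1 f /\ forall v, C1 ('D_v f).

End smooth_maps.

Definition C1_diffeo {R : realType} {V W : normedModType R} (f : V -> W) :=
  exists g : W -> V, [/\ cancel f g, cancel g f, C1 f & C1 g].

Definition homeo {V W : topologicalType} (f : V -> W) :=
  exists g : W -> V, [/\ cancel f g, cancel g f, continuous f & continuous g].

Section twist_maps.
Context {R : realType}.
Implicit Types (F : R * R -> R * R) (S : R * R -> R).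

Definition commutes_with_deck F : Prop :=
  forall x : R * R, F (x + (1, 0)) = F x + (1, 0).

(* An isotopy f_t of the annulus from id to f lifts to an isotopy of R x R from
   id to some lift of f, commuting with the deck translation.  Any other lift of
   f is of the form F + (k, 0) with k an integer, and is reached by lifting the
   isotopy f_t + (t k, 0) instead; so the condition does not depend on the lift. *)
Definition isotopic_to_id F : Prop :=
  exists H : R -> R * R -> R * R,
    [/\ {within `[0, 1] `*` setT, continuous (fun z : R * (R * R) => H z.1 z.2)},
        forall t, 0 <= t <= 1 -> homeo (H t) /\ commutes_with_deck (H t),
        H 0 = id & H 1 = F].

(* R dTheta - r dtheta = dh for some function h on the annulus. *)
Definition exact_symplectic F : Prop :=
  exists h : R * R -> R,
    [/\ periodic h (1, 0),
        forall x, differentiable h x &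
        forall x v, 'D_v h x = (F x).2 * ('D_v F x).1 - x.2 * v.1].

Definition twist F : Prop :=
  forall theta : R,
    {homo (fun r : R => (F (theta, r)).1) : r s / r < s} /\
    C1_diffeo (fun r : R => (F (theta, r)).1).

Definition symplectic_twist_map F : Prop :=
  [/\ C1_diffeo F, commutes_with_deck F, isotopic_to_id F,
      exact_symplectic F & twist F].

Definition dtheta S : R * R -> R := 'D_(1, 0) S.
Definition dTheta S : R * R -> R := 'D_(0, 1) S.

Definition decreasing_diffeo (g : R -> R) : Prop :=
  {homo g : x y /~ x < y} /\ C1_diffeo g.

(* The third condition is the superlinearity of S: S(theta, Theta) divided by
   |Theta - theta| tends to +oo, uniformly, as |Theta - theta| tends to +oo. *)
Definition generating_function F S : Prop :=
  [/\ C2 S,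
      periodic S (1, 1),
      (forall K : R, exists M : R, forall theta Theta : R,
         M < `|Theta - theta| -> K < S (theta, Theta) / `|Theta - theta|),
      (forall Theta0 : R,
         decreasing_diffeo (fun theta => dTheta S (theta, Theta0))) /\
      (forall theta0 : R,
         decreasing_diffeo (fun Theta => dtheta S (theta0, Theta)))
    & forall theta r Theta R' : R,
        F (theta, r) = (Theta, R') <->
        r = - dtheta S (theta, Theta) /\ R' = dTheta S (theta, Theta)].

(* When S is a generating function and v is continuous and periodic, the range
   below is bounded from below, so that inf is a genuine infimum. *)
Definition weak_KAM_equation S (c a : R) (v : R -> R) : Prop :=
  forall theta : R,
    v theta = inf (range (fun theta' : R =>
      v theta' + S (theta', theta) + c * (theta' - theta) + a)).

Definition has_weak_KAM S (c a : R) : Prop :=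
  exists v : R -> R,
    [/\ periodic v 1, continuous v & weak_KAM_equation S c a v].

(* The unique a such that has_weak_KAM S c a. *)
Definition alpha S (c : R) : R := get [set a | has_weak_KAM S c a].

Definition weak_KAM_solution S (c : R) (v : R -> R) : Prop :=
  [/\ periodic v 1, continuous v & weak_KAM_equation S c (alpha S c) v].

Definition rotation_number S (c : R) : R := derive1 (alpha S) c.

Definition derivative_graph (g : R -> R) : set (R * R) :=
  [set x | derivable g x.1 1 /\ x.2 = derive1 g x.1].

Definition generalized_derivative (g : R -> R) (t : R) : set (R * R) :=
  [set x | x.1 = t /\
     smallest (@convex_set R R^o)
       [set p : R^o | closure (derivative_graph g) (t, p)] x.2].

(* The full pseudograph of c + g'. *)
Definition pseudograph (c : R) (g : R -> R) : set (R * R) :=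
  \bigcup_t [set (0, c) + x | x in generalized_derivative g t].

End twist_maps.

(* Main.v *)
Require Import Defs.
From mathcomp Require Import all_boot all_order all_algebra.
From mathcomp Require Import all_classical all_reals all_analysis.
From mathcomp Require Import ring lra.
Import Order.TTheory GRing.Theory Num.Theory.
Import numFieldNormedType.Exports.
Local Open Scope classical_set_scope.
Local Open Scope ring_scope.

Set Implicit Arguments.
Unset Strict Implicit.
Unset Printing Implicit Defensive.

(** Write [w_c t = u_c t + c t] and call [y] calibrated for [(c, t)] if it realizes
    the infimum defining [w_c t]. The reachable derivatives of [w_c] at [q] are
    numbers [dS/dTheta (y, q)] with [y] calibrated, and they include those of the
    smallest and of the largest calibrated [y]. Since [dS/dTheta] decreases in its
    first argument, both claims become statements about calibrated points.

    Covering: as [c] goes from -oo to +oo the calibrated points of [q], which depend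
    upper semicontinuously on [c], sweep the line from +oo to -oo; conclude by
    connectedness of the set of all [c].

    Order: by the twist condition the map "calibrated predecessor" is strictly
    increasing and has degree one, so all backward orbits for a given [c] have the
    same rotation number, which is continuous in [c] and lies between the left and
    right slopes of [alpha]: hence [alpha] is differentiable, and its derivative is
    this rotation number. If [rho c < rho c'] and the orbits of [q] started in the
    wrong order, they would have to cross again, which Aubry's crossing argument,
    applied to the monotone quantity [w_c' - w_c], forbids. *)

(** * One-variable calculus: minima, touching graphs, squeezed graphs *)

Section one_variable_calculus.
Context {R : realType}.
Implicit Types (f g : R -> R) (x t a b : R).

Lemma is_derive_quotient f x a : is_derive x 1 f a <->
  (fun s => s^-1 * (f (s + x) - f x)) @ 0^' --> a.
Proof.
have -> : (fun s => s^-1 * (f (s + x) - f x)) =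
    (fun s => s^-1 *: ((f \o shift x) (s *: (1 : R)) - f x)).
  by apply/funext => s /=; rewrite [s *: 1]mulr1.
split=> [[df <-]|df]; first exact: df.
split; first by apply/cvg_ex; exists a.
exact: cvg_lim df.
Qed.

Lemma near_shift x (P : R -> Prop) :
  (\forall t \near x, P t) -> \forall s \near 0, P (s + x).
Proof.
have : (fun s => s + x) @ (0 : R) --> x.
  by rewrite -[X in _ --> X]add0r; apply: cvgD; [exact: cvg_id|exact: cvg_cst].
by move=> + Px => /(_ _ Px).
Qed.

Lemma derive_local_min f x a : is_derive x 1 f a ->
  (\forall t \near x, f x <= f t) -> a = 0.
Proof.
move=> /is_derive_quotient df /near_shift fmin.
apply/eqP; rewrite eq_le; apply/andP; split.
- have dl : (fun s => s^-1 * (f (s + x) - f x)) @ 0^'- --> a.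
    apply: cvg_trans df; apply: cvg_app => A [e e0 Ae].
    by exists e => // y xy y0; apply: Ae => //; rewrite lt_eqF.
  apply: cvgr_to_le dl _.
  near=> s; apply: mulr_le0_ge0; first by rewrite invr_le0 ltW.
  by rewrite subr_ge0; near: s; exact: cvg_within fmin.
- have dr : (fun s => s^-1 * (f (s + x) - f x)) @ 0^'+ --> a.
    apply: cvg_trans df; apply: cvg_app => A [e e0 Ae].
    by exists e => // y xy y0; apply: Ae => //; rewrite gt_eqF.
  apply: cvgr_to_ge dr _.
  near=> s; apply: mulr_ge0; first by rewrite invr_ge0 ltW.
  by rewrite subr_ge0; near: s; exact: cvg_within fmin.
Unshelve. all: by end_near. Qed.

Lemma derive_touching f g x a b : is_derive x 1 f a -> is_derive x 1 g b ->
  f x = g x -> (\forall t \near x, f t <= g t) -> a = b.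
Proof.
move=> df dg fg le_fg.
suff: b - a = 0 by move/subr0_eq.
apply: (@derive_local_min (g - f) x).
by apply: filterS le_fg => t; rewrite !fctE fg subrr subr_ge0.
Qed.

(** The quotient of [k] lies between those of [f] and [g], in an order that depends on the sign of
    [s]. *)
Lemma derive_sandwich f g k x a : is_derive x 1 f a -> is_derive x 1 g a ->
  f x = k x -> g x = k x ->
  (\forall t \near x, f t <= k t <= g t) -> is_derive x 1 k a.
Proof.
move=> /is_derive_quotient df /is_derive_quotient dg fx gx /near_shift fkg.
apply/is_derive_quotient/cvgrPdist_lt.
move: df dg => /cvgrPdist_lt df /cvgrPdist_lt dg e e0; near=> s.
have : f (s + x) <= k (s + x) <= g (s + x) by near: s; apply: cvg_within fkg.
have : `|a - s^-1 * (f (s + x) - f x)| < e by near: s; exact: df.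
have : `|a - s^-1 * (g (s + x) - g x)| < e by near: s; exact: dg.
rewrite fx gx => dg' df' /andP[fk kg].
move: dg' df'; rewrite !ltr_norml => /andP[g1 g2] /andP[f1 f2].
have /ler_wpM2l lef : f (s + x) - k x <= k (s + x) - k x by rewrite lerB.
have /ler_wpM2l leg : k (s + x) - k x <= g (s + x) - k x by rewrite lerB.
have /ler_wnM2l gef : f (s + x) - k x <= k (s + x) - k x by rewrite lerB.
have /ler_wnM2l geg : k (s + x) - k x <= g (s + x) - k x by rewrite lerB.
have [s0|/ltW s0] := leP 0 s^-1.
- by move: (lef _ s0) (leg _ s0); lra.
- by move: (gef _ s0) (geg _ s0); lra.
Unshelve. all: by end_near. Qed.

End one_variable_calculus.

Lemma is_derive_affine {R : realType} (c k t : R) :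
  is_derive t 1 (fun s => c * s + k) c.
Proof.
have -> : (fun s => c * s + k) = (c \*: (@id R)) + cst k by [].
by apply: is_derive_eq; rewrite addr0; exact: mulr1.
Qed.

Lemma is_derive_parabola {R : realType} (C m k t : R) :
  is_derive t 1 (fun s => k - C * (s - m) ^+ 2) (- (C * (2 * (t - m)))).
Proof.
have -> : (fun s => k - C * (s - m) ^+ 2) = cst k - C \*: (id - cst m : R -> R) ^+ 2.
  by apply/funext => s; rewrite !fctE.
apply: is_derive_eq; rewrite sub0r subr0; congr (- (C * _)).
by rewrite expr1; exact: mulr1.
Qed.

Lemma near_not_closure {T : topologicalType} (A : set T) x : ~ closure A x ->
  \forall y \near x, ~ A y.
Proof.
move=> /existsNP[B /not_implyP[Bx AB0]].
by apply: filterS Bx => y By Ay; apply: AB0; exists y.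
Qed.

(** * Pseudographs as fiberwise convex hulls *)

Section pseudographs.
Context {R : realType}.

Lemma conv_regularE (l : {i01 R}) (x y : convex_lmodType R^o) :
  conv l x y = l%:num * (x : R) + (1 - l%:num) * (y : R).
Proof. by []. Qed.

Implicit Types (c b q p : R) (g : R -> R).

(** An open half-line is convex, so a strict bound on the reachable derivatives passes to their
    hull. *)
Lemma pseudograph_lt c g b q p :
  (forall p', closure (derivative_graph g) (q, p') -> c + p' < b) ->
  pseudograph c g (q, p) -> p < b.
Proof.
move=> closure_lt [t _ [[t' p'] [/= -> hull] [+ <-]]].
rewrite add0r => tq; have := hull [set x : R^o | c + x < b]; apply; split; last first.
  by move=> x /=; rewrite tq; exact: closure_lt.
move=> x y l; rewrite !inE /= conv_regularE => xb yb.
have l0 : 0 <= l%:num :> R by [].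
have l1 : 0 <= 1 - l%:num :> R by rewrite subr_ge0.
have [/ltW|] := ltP (x : R) y; rewrite -subr_ge0 => xy.
- by move: (mulr_ge0 l0 xy) (mulr_ge0 l1 xy); lra.
- by move: (mulr_ge0 l0 xy) (mulr_ge0 l1 xy); lra.
Qed.

Lemma pseudograph_gt c g b q p :
  (forall p', closure (derivative_graph g) (q, p') -> b < c + p') ->
  pseudograph c g (q, p) -> b < p.
Proof.
move=> closure_gt [t _ [[t' p'] [/= -> hull] [+ <-]]].
rewrite add0r => tq; have := hull [set x : R^o | b < c + x]; apply; split; last first.
  by move=> x /=; rewrite tq; exact: closure_gt.
move=> x y l; rewrite !inE /= conv_regularE => xb yb.
have l0 : 0 <= l%:num :> R by [].
have l1 : 0 <= 1 - l%:num :> R by rewrite subr_ge0.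
have [/ltW|] := ltP (x : R) y; rewrite -subr_ge0 => xy.
- by move: (mulr_ge0 l0 xy) (mulr_ge0 l1 xy); lra.
- by move: (mulr_ge0 l0 xy) (mulr_ge0 l1 xy); lra.
Qed.

Lemma pseudograph_between c g q p p1 p2 :
  closure (derivative_graph g) (q, p1) -> closure (derivative_graph g) (q, p2) ->
  c + p1 <= p <= c + p2 -> pseudograph c g (q, p).
Proof.
move=> clp1 clp2 /andP[p1p pp2]; exists q => //; exists (q, p - c); last first.
  by congr (_, _) => /=; [rewrite add0r|rewrite addrC subrK].
split=> //= B [convB clB].
(* If [p2 <= p1] then [p1], [p - c] and [p2] coincide, and the weight used below would be 0/0. *)
have [p12|p12] := leP p2 p1.
  have -> : p - c = p1 by lra.
  exact: clB.
have l0 : 0 <= (p2 - (p - c)) / (p2 - p1) by apply: divr_ge0; lra.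
have l1 : (p2 - (p - c)) / (p2 - p1) <= 1 by rewrite ler_pdivrMr; lra.
have := convB p1 p2 (Itv01 l0 l1); rewrite !inE => /(_ (clB _ clp1) (clB _ clp2)).
rewrite conv_regularE /=; congr (B _); field; lra.
Qed.

End pseudographs.

Lemma periodic_int {R : realType} (f : R -> R) (j : int) x :
  periodic f 1 -> f (x + j%:~R) = f x.
Proof.
move=> fper; case: j => n; first by rewrite -(periodicn fper n x).
by rewrite NegzE mulrNz -(periodicn fper n.+1 (x - _)) subrK.
Qed.

(** * The generating function: twist, crossing, translation invariance *)

Section generating_function.
Context {R : realType} (F : R * R -> R * R) (S : R * R -> R).
Context (S_generating : generating_function F S).
Implicit Types a b p t : R.

Lemma generating_differentiable x : differentiable S x.
Proof. by case: S_generating => -[[]]. Qed.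

Lemma generating_continuous : continuous S.
Proof. by move=> x; exact/differentiable_continuous/generating_differentiable. Qed.

Lemma dTheta_continuous : continuous (dTheta S).
Proof. by case: S_generating => -[[_]] /(_ (0, 1)). Qed.

Lemma is_derive_dTheta a b : is_derive b 1 (fun t => S (a, t)) (dTheta S (a, b)).
Proof.
apply/is_derive_quotient.
have : derivable S (a, b) (0, 1) by exact/diff_derivable/generating_differentiable.
rewrite /derivable /dTheta /derive.
suff -> : (fun h => h^-1 *: ((S \o shift (a, b)) (h *: (0, 1)) - S (a, b))) =
  (fun s => s^-1 * (S (a, s + b) - S (a, b))) by [].
apply/funext => h /=; congr (_ * (S (_, _) - _)) => /=.
  by rewrite scaler0 add0r.
by rewrite [_ *: _]mulr1.
Qed.

Lemma is_derive_dtheta a b : is_derive a 1 (fun t => S (t, b)) (dtheta S (a, b)).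
Proof.
apply/is_derive_quotient.
have : derivable S (a, b) (1, 0) by exact/diff_derivable/generating_differentiable.
rewrite /derivable /dtheta /derive.
suff -> : (fun h => h^-1 *: ((S \o shift (a, b)) (h *: (1, 0)) - S (a, b))) =
  (fun s => s^-1 * (S (s + a, b) - S (a, b))) by [].
apply/funext => h /=; congr (_ * (S (_, _) - _)) => /=.
  by rewrite [_ *: _]mulr1.
by rewrite scaler0 add0r.
Qed.

Lemma dTheta_decreasing b a a' : a < a' -> dTheta S (a', b) < dTheta S (a, b).
Proof. by case: S_generating => _ _ _ [/(_ b)[+ _] _] _ => /(_ a' a); exact. Qed.

Lemma dTheta_nonincreasing b a a' : a <= a' -> dTheta S (a', b) <= dTheta S (a, b).
Proof.
by rewrite le_eqVlt => /predU1P[->//|/(dTheta_decreasing b)/ltW].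
Qed.

Lemma dTheta_inj b a a' : dTheta S (a, b) = dTheta S (a', b) -> a = a'.
Proof.
by have [/(dTheta_decreasing b)|/(dTheta_decreasing b)|//] := ltgtP a a' => + e;
  rewrite e ltxx.
Qed.

Lemma dTheta_surj b p : exists a, dTheta S (a, b) = p.
Proof.
case: S_generating => _ _ _ [/(_ b)[_ [g [_ gK _ _]]] _] _.
by exists (g p); exact: gK.
Qed.

Lemma dtheta_inj a b b' : dtheta S (a, b) = dtheta S (a, b') -> b = b'.
Proof.
case: S_generating => _ _ _ [_ /(_ a)[+ _]] _ => decr.
by have [/decr|/decr|//] := ltgtP b b' => + e; rewrite e ltxx.
Qed.

(** The twist condition in integrated form: [S (a', t) - S (a, t)] increases with [t]. *)
Lemma generating_crossing a a' b b' : a' < a -> b < b' ->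
  S (a, b') + S (a', b) < S (a, b) + S (a', b').
Proof.
move=> aa bb.
pose g := (fun t => S (a', t)) - (fun t => S (a, t)).
have dg t : is_derive t 1 g (dTheta S (a', t) - dTheta S (a, t)).
  exact: is_deriveB (is_derive_dTheta a' t) (is_derive_dTheta a t).
have dg' t : derivable g t 1 by have [] := dg t.
suff : g b < g b' by rewrite /g !fctE; lra.
apply: (@gtr0_derive1_lt_cc _ g b b') => //.
- move=> t _; rewrite derive1E derive_val subr_gt0; exact: dTheta_decreasing.
- exact: derivable_within_continuous.
- by rewrite in_itv/= lexx ltW.
- by rewrite in_itv/= lexx ltW.
Qed.

Lemma generating_shift (j : int) a b : S (a + j%:~R, b + j%:~R) = S (a, b).
Proof.
have /(periodic_int j 0) : periodic (fun t => S (a + t, b + t)) 1.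
  by move=> t; case: S_generating => _ + _ _ _ => /(_ (a + t, b + t)); rewrite !addrA.
by rewrite add0r !addr0.
Qed.

End generating_function.

(** * Costs and calibrated points *)

Section calibration.
Context {R : realType} (F : R * R -> R * R) (S u : R * R -> R).
Context (S_generating : generating_function F S) (u_periodic : periodic u (1, 0))
  (u_continuous : continuous u)
  (u_weak_KAM : forall c, weak_KAM_solution S c (fun t => u (t, c))).
Implicit Types c t y z : R.

(** The bracket of the weak K.A.M. equation without [alpha S c]; [t] is the end point, [y] a
    candidate predecessor. *)
Definition cost c t y := u (y, c) + S (y, t) + c * (y - t).

Definition calibrated c t y := forall z, cost c t y <= cost c t z.

Lemma u_int (j : int) t c : u (t + j%:~R, c) = u (t, c).
Proof.
apply: (@periodic_int _ (fun t => u (t, c))) => {}t.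
by rewrite -[RHS]u_periodic; congr (u (_, _)); rewrite /= addr0.
Qed.

Lemma cost_int (j : int) c t y : cost c (t + j%:~R) (y + j%:~R) = cost c t y.
Proof. by rewrite /cost u_int (generating_shift S_generating); ring. Qed.

Lemma calibrated_int (j : int) c t y :
  calibrated c t y -> calibrated c (t + j%:~R) (y + j%:~R).
Proof.
move=> cal z; rewrite cost_int (le_trans (cal (z - j%:~R)))//.
by rewrite -(cost_int j) subrK.
Qed.

Lemma cost_continuous : continuous (fun x : (R * R) * R => cost x.1.1 x.1.2 x.2).
Proof.
move=> x; rewrite /cost.
have c11 : {for x, continuous (fun x : (R * R) * R => x.1.1)}.
  by apply: continuous_comp; [exact: cvg_fst|exact: cvg_fst].
have c12 : {for x, continuous (fun x : (R * R) * R => x.1.2)}.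
  by apply: continuous_comp; [exact: cvg_fst|exact: cvg_snd].
have c2 : {for x, continuous (fun x : (R * R) * R => x.2)} by exact: cvg_snd.
apply: cvgD; [apply: cvgD|].
- apply: (@continuous_comp _ _ _ (fun x : (R * R) * R => (x.2, x.1.1)) u).
    exact: cvg_pair c2 c11.
  exact: u_continuous.
- apply: (@continuous_comp _ _ _ (fun x : (R * R) * R => (x.2, x.1.2)) S).
    exact: cvg_pair c2 c12.
  exact: (generating_continuous S_generating).
- by apply: cvgM => //; apply: cvgB.
Qed.

(* A far away [y] is beaten by its translate in [`[t, t + 1[], by superlinearity. *)
Lemma cost_coercive (C q : R) : exists2 M, 0 <= M & forall c t y,
  `|c| <= C -> `|t - q| <= 1 -> M < `|y| ->
  exists2 z, `|z| <= M & cost c t z < cost c t y.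
Proof.
(* Contains every [(z, t)] with [t] within 1 of [q] and [z] in [[t, t + 1[]. *)
pose K := (`[q - 1, q + 2] `*` `[q - 1, q + 1])%classic : set (R * R).
have [B BS] : exists B, forall x, K x -> S x <= B.
  have K0 : K !=set0 by exists (q, q); split => /=; rewrite in_itv/=; lra.
  have cK : compact K by apply: compact_setX; exact: segment_compact.
  have [x _ xmax] := compact_EVT_max K0 cK
    (continuous_subspaceT (generating_continuous S_generating)).
  by exists (S x) => y Ky; apply: xmax; rewrite inE.
(* Slope [C + 1] leaves a surplus [|y - t|] over the linear term, whose slope is at most [C]. In the
   bound, [|q| + 2] controls [z]; the rest puts [y] past the threshold [M0] and makes the surplus
   exceed [|B| + |C|]. *)
case: (S_generating) => _ _ /(_ (C + 1))[M0 superlin] _ _.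
exists (`|q| + 2 + `|M0| + `|B| + `|C|).
  by rewrite !addr_ge0.
move=> c t y cC tq yM.
have d_large : `|M0| + `|B| + `|C| < `|y - t|.
  have := ler_normD (y - t) (t - q); have := ler_normD (y - t + (t - q)) q.
  by rewrite (_ : y - t + (t - q) + q = y); [lra|ring].
pose j := Num.floor (y - t); pose z := y - j%:~R.
have /andP[jl ju] := floor_itv (y - t); rewrite intrD in ju.
exists z.
  have := ler_normD (z - t) (t - q); have := ler_normD (z - t + (t - q)) q.
  rewrite (_ : z - t + (t - q) + q = z); last by ring.
  have -> : `|z - t| = z - t by rewrite ger0_norm// /z; lra.
  by rewrite /z; have := normr_ge0 M0; have := normr_ge0 B; have := normr_ge0 C; lra.
have Sy : (C + 1) * `|y - t| < S (y, t).
  rewrite -ltr_pdivlMr; last first.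
    by apply: le_lt_trans d_large; rewrite !addr_ge0.
  rewrite distrC; apply: superlin.
  rewrite distrC; apply: le_lt_trans d_large; rewrite -addrA.
  by rewrite (le_trans (ler_norm _))// lerDl addr_ge0.
have Sz : S (z, t) <= B.
  move: tq; rewrite ler_norml => /andP[tq1 tq2].
  by apply: BS; split; rewrite /z /= in_itv/=; apply/andP; split; lra.
have cz : c * (z - t) <= C.
  rewrite (le_trans (ler_norm _))// normrM -[leRHS]mulr1 ler_pM//.
  by rewrite ger0_norm /z; lra.
have cy : - (C * `|y - t|) <= c * (y - t).
  by rewrite lerNl (le_trans (ler_norm _))// normrN normrM ler_wpM2r.
have -> : cost c t z = u (y, c) + S (z, t) + c * (z - t).
  by rewrite /cost -(u_int j z) /z subrK.
rewrite /cost; move: (ler_norm B) (normr_ge0 M0) (ler_norm C); lra.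
Qed.

Lemma calibrated_bound (C q : R) : exists M, forall c t y,
  `|c| <= C -> `|t - q| <= 1 -> calibrated c t y -> `|y| <= M.
Proof.
have [M M0 coercive] := cost_coercive C q; exists M => c t y cC tq cal.
rewrite leNgt; apply/negP => /(coercive _ _ _ cC tq)[z _].
by rewrite ltNge cal.
Qed.

(** By coercivity, a minimum over [[- M, M]] is global. *)
Lemma calibrated_exists c t : exists y, calibrated c t y.
Proof.
have [M M0 coercive] := cost_coercive `|c| t.
have cont : continuous (cost c t).
  move=> y; apply: (@continuous_comp _ _ _ (fun y : R => ((c, t), y))
    (fun x : (R * R) * R => cost x.1.1 x.1.2 x.2)).
    exact: cvg_pair (@cvg_cst _ (c, t) _ (nbhs y) _) cvg_id.
  exact: cost_continuous.
have [|y _ ymin] := @EVT_min _ (cost c t) (- M) M _ (continuous_subspaceT cont).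
  lra.
have {}ymin z : `|z| <= M -> cost c t y <= cost c t z.
  by move=> zM; apply: ymin; rewrite in_itv/= -ler_norml.
exists y => z; have [/ymin//|Mz] := leP `|z| M.
have tt : `|t - t| <= 1 by rewrite subrr normr0.
have [z' /ymin yz' /ltW z'z] := coercive c t z (lexx _) tt Mz.
exact: le_trans yz' z'z.
Qed.

Lemma u_le_cost c t y : u (t, c) <= cost c t y + alpha S c.
Proof.
have [_ _ /(_ t) ->] := u_weak_KAM c.
(* A minimizer shows the range to be bounded below, so that [inf] is a true infimum. *)
have [x xcal] := calibrated_exists c t.
apply: ge_inf; last by exists y => //; rewrite /cost; ring.
exists (cost c t x + alpha S c) => _ [z _ <-]; by move: (xcal z); rewrite /cost; lra.
Qed.

Lemma u_calibrated c t y : calibrated c t y -> u (t, c) = cost c t y + alpha S c.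
Proof.
move=> ycal; apply/eqP; rewrite eq_le u_le_cost /=.
have [_ _ /(_ t) ->] := u_weak_KAM c.
apply: lb_le_inf; first by exists (u (0, c) + S (0, t) + c * (0 - t) + alpha S c), 0.
by move=> _ [z _ <-]; move: (ycal z); rewrite /cost; lra.
Qed.

(** A strictly cheaper competitor stays cheaper nearby, by joint continuity of the cost. *)
Lemma near_not_calibrated c t y : ~ calibrated c t y ->
  \forall x \near ((c, t), y), ~ calibrated x.1.1 x.1.2 x.2.
Proof.
move=> /existsNP[z /negP]; rewrite -ltNge => cost_lt.
have cz : {for ((c, t), y), continuous (fun x : (R * R) * R => cost x.1.1 x.1.2 z)}.
  apply: (@continuous_comp _ _ _ (fun x : (R * R) * R => (x.1, z))
    (fun x : (R * R) * R => cost x.1.1 x.1.2 x.2)).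
    exact: cvg_pair cvg_fst (@cvg_cst _ z _ (nbhs ((c, t), y)) _).
  exact: cost_continuous.
have cy : {for ((c, t), y),
    continuous (fun x : (R * R) * R => cost x.1.1 x.1.2 x.2)}.
  exact: cost_continuous.
near=> x => /(_ z); apply/negP; rewrite -ltNge -subr_gt0; near: x.
apply: (cvgr_gt (cost c t y - cost c t z)); last by rewrite subr_gt0.
exact: cvgB cy cz.
Unshelve. all: by end_near. Qed.

Lemma near_compact_not_calibrated (K : set R) c t : compact K ->
  (forall y, K y -> ~ calibrated c t y) ->
  \forall c' \near c, forall y, K y -> ~ calibrated c' t y.
Proof.
move=> /compact_near_coveringP Kcov not_cal.
apply: (Kcov _ (nbhs c) (fun c' y => ~ calibrated c' t y)) => y /not_cal.
move=> /near_not_calibrated near_not.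
have cont : {for (y, c), continuous (fun x : R * R => ((x.2, t), x.1))}.
  apply: (@cvg_pair _ _ _ _ (nbhs (c, t)) (nbhs y)); last exact: cvg_fst.
  exact: cvg_pair cvg_snd (@cvg_cst _ t _ (nbhs (y, c)) _).
exact: (cont _ near_not).
Qed.

(* First order condition at [y] for [s |-> S (z, s) + S (s, t)]. *)
Lemma calibrated_euler_lagrange c t y z : calibrated c t y -> calibrated c y z ->
  dTheta S (z, y) + dtheta S (y, t) = 0.
Proof.
move=> ty yz.
apply: (@derive_local_min _ ((fun s => S (z, s)) + (fun s => S (s, t))) y).
  apply: is_deriveD; first exact: (is_derive_dTheta S_generating).
  exact: (is_derive_dtheta S_generating).
near=> s; rewrite !fctE.
move: (u_le_cost c s z) (u_calibrated yz) (ty s); rewrite /cost; lra.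
Unshelve. all: by end_near. Qed.

(** * Comparison of two cohomology classes and monotonicity *)

(* With [w_c t = u (t, c) + c t], this is [w_c' - w_c]. *)
Definition gap c c' t := (u (t, c') + c' * t) - (u (t, c) + c * t).

(** From [y] to [t], [w_c] grows by exactly [S (y, t) + alpha S c], and [w_c'] by at most
    [S (y, t) + alpha S c']. *)
Lemma gap_calibrated_l c c' t y : calibrated c t y ->
  gap c c' t <= gap c c' y + (alpha S c' - alpha S c).
Proof.
by move=> /u_calibrated; move: (u_le_cost c' t y); rewrite /gap /cost; lra.
Qed.

Lemma gap_calibrated_r c c' t y : calibrated c' t y ->
  gap c c' y + (alpha S c' - alpha S c) <= gap c c' t.
Proof.
by move=> /u_calibrated; move: (u_le_cost c t y); rewrite /gap /cost; lra.
Qed.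

(** Swapping the end points of two crossing segments strictly lowers the total of [S], and the
    swapped segments bound [w_c t'] and [w_c' t] from above. *)
Lemma calibrated_crossing c c' t t' y y' : calibrated c t y ->
  calibrated c' t' y' -> t < t' -> y' < y -> gap c c' t < gap c c' t'.
Proof.
move=> /u_calibrated ty /u_calibrated ty' tt yy.
have := generating_crossing S_generating yy tt.
by move: ty ty' (u_le_cost c t' y) (u_le_cost c' t y'); rewrite /gap /cost; lra.
Qed.

(** Crossing is excluded because [gap c c] vanishes. A common predecessor [y] is excluded because
    the Euler-Lagrange equation recovers [t] from [y] and a predecessor of [y]. *)
Lemma calibrated_lt c t t' y y' :
  t < t' -> calibrated c t y -> calibrated c t' y' -> y < y'.
Proof.
move=> tt ty ty'; have [//|yy|yy] := ltgtP y y'.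
  by move: (calibrated_crossing ty ty' tt yy); rewrite /gap !subrr ltxx.
subst y'; have [z yz] := calibrated_exists c y.
move: (calibrated_euler_lagrange ty yz) (calibrated_euler_lagrange ty' yz) => e.
rewrite -[RHS]e => /addrI/esym/(dtheta_inj S_generating) e'.
by rewrite e' ltxx in tt.
Qed.

(** * The predecessor map and its displacement *)

(* Choosing modulo 1 makes [prev c] commute with integer translations. *)
Definition prev c t : R :=
  projT1 (cid (calibrated_exists c (t - (Num.floor t)%:~R))) + (Num.floor t)%:~R.

Lemma calibrated_prev c t : calibrated c t (prev c t).
Proof.
rewrite /prev; case: cid => y /= /(calibrated_int (Num.floor t)).
by rewrite subrK.
Qed.

Lemma prev_int c t (j : int) : prev c (t + j%:~R) = prev c t + j%:~R.
Proof.
rewrite /prev floorDrz ?intr_int// intrKfloor intrD.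
by rewrite (_ : t + _ - (_ + _) = t - (Num.floor t)%:~R) ?addrA//; ring.
Qed.

Lemma prev_lt c t t' : t < t' -> prev c t < prev c t'.
Proof. by move=> tt; apply: calibrated_lt tt _ _; exact: calibrated_prev. Qed.

Lemma iter_prev_lt c n t t' : t < t' -> iter n (prev c) t < iter n (prev c) t'.
Proof. by move=> tt; elim: n => //= n; exact: prev_lt. Qed.

Lemma iter_prev_le c n t t' : t <= t' -> iter n (prev c) t <= iter n (prev c) t'.
Proof. by rewrite le_eqVlt => /predU1P[->//|/(iter_prev_lt c n)/ltW]. Qed.

Lemma iter_prev_int c n t (j : int) :
  iter n (prev c) (t + j%:~R) = iter n (prev c) t + j%:~R.
Proof. by elim: n => //= n ->; exact: prev_int. Qed.

Definition displacement c n t := iter n (prev c) t - t.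

(** [t] lies below the translate of [t'] by [floor (t - t') + 1], which exceeds it by at most 1;
    iterates are increasing and commute with translations. *)
Lemma displacement_le c n t t' : displacement c n t <= displacement c n t' + 1.
Proof.
have /andP[fl fu] := floor_itv (t - t'); rewrite intrD in fu.
have := @iter_prev_le c n t (t' + (Num.floor (t - t') + 1)%:~R).
rewrite iter_prev_int intrD /displacement => /(_ _).
by move=> H; have {}H := H ltac:(lra); lra.
Qed.

(** Each of the [k] blocks of [n] steps moves by [displacement c n t] up to 1. *)
Lemma displacement_mul c k n t :
  k%:R * (displacement c n t - 1) <= displacement c (k * n)%N t
    <= k%:R * (displacement c n t + 1).
Proof.
elim: k => [|k]; first by rewrite /displacement !mul0r subrr lexx.
have -> : displacement c (k.+1 * n)%N t =
    displacement c n (iter (k * n) (prev c) t) + displacement c (k * n)%N t.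
  by rewrite /displacement mulSn iterD; ring.
rewrite -natr1 => /andP[lo up].
have := displacement_le c n (iter (k * n) (prev c) t) t.
have := displacement_le c n t (iter (k * n) (prev c) t).
by move=> *; apply/andP; split; lra.
Qed.

Lemma u_bounded c : exists B, forall t, `|u (t, c)| <= B.
Proof.
have cont : continuous (fun t => u (t, c)) by case: (u_weak_KAM c).
have [s _ smin] := EVT_min ler01 (continuous_subspaceT cont).
have [r _ rmax] := EVT_max ler01 (continuous_subspaceT cont).
exists (`|u (s, c)| + `|u (r, c)|) => t.
have -> : u (t, c) = u (t - (Num.floor t)%:~R, c).
  by rewrite -[RHS](u_int (Num.floor t)) subrK.
have t01 : t - (Num.floor t)%:~R \in `[0, 1].
  by have /andP[] := floor_itv t; rewrite intrD in_itv/= => *; apply/andP; split; lra.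
move: (smin _ t01) (rmax _ t01); rewrite ler_norml.
have := ler_norm (u (r, c)); have := ler_norm (- u (s, c)); rewrite normrN.
have := normr_ge0 (u (r, c)); have := normr_ge0 (u (s, c)).
by move=> *; apply/andP; split; lra.
Qed.

Lemma gap_bounded c c' : exists B, forall t, `|gap c c' t - (c' - c) * t| <= B.
Proof.
have [B uB] := u_bounded c; have [B' uB'] := u_bounded c'; exists (B' + B) => t.
rewrite (_ : _ - _ = u (t, c') - u (t, c)); last by rewrite /gap; ring.
by rewrite (le_trans (ler_normB _ _))// lerD.
Qed.

Lemma gap_iter_l c c' n t :
  gap c c' t <= gap c c' (iter n (prev c) t) + n%:R * (alpha S c' - alpha S c).
Proof.
elim: n => [|n /=]; first by rewrite mul0r addr0.
have := gap_calibrated_l c' (calibrated_prev c (iter n (prev c) t)).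
by rewrite -natr1; lra.
Qed.

Lemma gap_iter_r c c' n t :
  gap c c' (iter n (prev c') t) + n%:R * (alpha S c' - alpha S c) <= gap c c' t.
Proof.
elim: n => [|n /=]; first by rewrite mul0r addr0.
have := gap_calibrated_r c (calibrated_prev c' (iter n (prev c') t)).
by rewrite -natr1; lra.
Qed.

Lemma archimedean_ge0 (a b : R) : (forall k : nat, - b <= k%:R * a) -> 0 <= a.
Proof.
move=> kab; rewrite leNgt; apply/negP => a0.
have b0 : 0 <= b by have := kab 0%N; rewrite mul0r oppr_le0.
have := archi_boundP (divr_ge0 b0 (ltW (_ : 0 < - a))); rewrite oppr_gt0 a0 => /(_ erefl).
rewrite ltr_pdivrMr ?oppr_gt0//; have := kab (Num.bound (b / - a)).
by rewrite mulrN; lra.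
Qed.

(** Over [k * n] steps the gap is linear of slope [c' - c] up to an error free of [k], which
    disappears as [k] grows. For [c < c'] and [n > 0], the slope of [alpha] over [[c, c']] is thus
    at least [- (displacement c n t + 1) / n]. *)
Lemma displacement_slope_l c c' n t : c <= c' ->
  0 <= (c' - c) * (displacement c n t + 1) + n%:R * (alpha S c' - alpha S c).
Proof.
move=> cc; have [B gapB] := gap_bounded c c'.
apply: (@archimedean_ge0 _ (B + B)) => k.
have /andP[_] := displacement_mul c k n t.
have cc0 : 0 <= c' - c by rewrite subr_ge0.
move=> /(ler_wpM2l cc0).
have := gap_iter_l c c' (k * n) t; rewrite natrM.
move: (gapB t) (gapB (iter (k * n) (prev c) t)); rewrite !ler_norml.
rewrite [displacement c (k * n) t]/displacement => /andP[g1 _] /andP[_ g2]; lra.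
Qed.

(** The same argument along the orbit for [c'] bounds this slope from above. *)
Lemma displacement_slope_r c c' n t : c <= c' ->
  (c' - c) * (displacement c' n t - 1) + n%:R * (alpha S c' - alpha S c) <= 0.
Proof.
move=> cc; have [B gapB] := gap_bounded c c'.
rewrite -oppr_ge0; apply: (@archimedean_ge0 _ (B + B)) => k.
have /andP[+ _] := displacement_mul c' k n t.
have cc0 : 0 <= c' - c by rewrite subr_ge0.
move=> /(ler_wpM2l cc0).
have := gap_iter_r c c' (k * n) t; rewrite natrM.
move: (gapB t) (gapB (iter (k * n) (prev c') t)); rewrite !ler_norml.
rewrite [displacement c' (k * n) t]/displacement => /andP[_ g1] /andP[g2 _]; lra.
Qed.

(** * Dependence of calibrated orbits on the cohomology class *)

Lemma near_le_normD1 c : \forall c' \near c, `|c'| <= `|c| + 1.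
Proof.
near=> c'; have : `|c - c'| < 1 by near: c'; exact: cvgr_dist_lt.
by have := ler_normB c (c - c'); rewrite subKr; lra.
Unshelve. all: by end_near. Qed.

(** Points beyond [M] are not calibrated for any nearby class, so only the compact [[b, M]] has to
    be avoided. *)
Lemma near_calibrated_lt c t b : (forall y, calibrated c t y -> y < b) ->
  \forall c' \near c, forall y, calibrated c' t y -> y < b.
Proof.
move=> lt_b; have [M bounded] := calibrated_bound (`|c| + 1) t.
have not_cal y : `[b, M]%classic y -> ~ calibrated c t y.
  by rewrite /= in_itv/= => /andP[+ _] /lt_b; rewrite leNgt => /negP.
have near_not := near_compact_not_calibrated (@segment_compact _ _ _) not_cal.
apply: filterS2 near_not (near_le_normD1 c) => c' c'_not c'C y cal.
rewrite ltNge; apply/negP => by'; apply: (c'_not y) => //.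
have tt : `|t - t| <= 1 by rewrite subrr normr0.
by rewrite /= in_itv/= by'/= (le_trans (ler_norm _) (bounded c' t y c'C tt cal)).
Qed.

Lemma near_calibrated_gt c t b : (forall y, calibrated c t y -> b < y) ->
  \forall c' \near c, forall y, calibrated c' t y -> b < y.
Proof.
move=> gt_b; have [M bounded] := calibrated_bound (`|c| + 1) t.
have not_cal y : `[- M, b]%classic y -> ~ calibrated c t y.
  by rewrite /= in_itv/= => /andP[_ +] /gt_b; rewrite leNgt => /negP.
have near_not := near_compact_not_calibrated (@segment_compact _ _ _) not_cal.
apply: filterS2 near_not (near_le_normD1 c) => c' c'_not c'C y cal.
rewrite ltNge; apply/negP => by'; apply: (c'_not y) => //.
have tt : `|t - t| <= 1 by rewrite subrr normr0.
rewrite /= in_itv/= by' andbT.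
by have := bounded c' t y c'C tt cal; rewrite ler_norml => /andP[].
Qed.

(** The midpoint [m] of [t] and [t'] leaves room: for [c'] near [c], [prev c' t] lies below
    [prev c m], itself strictly below [prev c t'], and induction applies to these two. *)
Lemma near_iter_prev_lt c n t t' : t < t' ->
  \forall c' \near c, iter n (prev c') t < iter n (prev c) t'.
Proof.
elim: n t t' => [|n IH] t t' tt; first by near=> c'.
have tm : t < (t + t') / 2 by lra.
have mt : (t + t') / 2 < t' by lra.
have near_n := IH _ _ (prev_lt c mt).
have near_1 := near_calibrated_lt
  (fun y cal => calibrated_lt tm cal (calibrated_prev c _)).
near=> c'; rewrite !iterSr.
apply: le_lt_trans (_ : iter n (prev c') (prev c ((t + t') / 2)) < _); last first.
  by near: c'.
apply: iter_prev_le; apply: ltW; have := calibrated_prev c' t.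
move: (prev c' t); near: c'; exact: near_1.
Unshelve. all: by end_near. Qed.

Lemma near_iter_prev_gt c n t t' : t' < t ->
  \forall c' \near c, iter n (prev c) t' < iter n (prev c') t.
Proof.
elim: n t t' => [|n IH] t t' tt; first by near=> c'.
have tm : (t + t') / 2 < t by lra.
have mt : t' < (t + t') / 2 by lra.
have near_n := IH _ _ (prev_lt c mt).
have near_1 := near_calibrated_gt
  (fun y => calibrated_lt tm (calibrated_prev c _)).
near=> c'; rewrite !iterSr.
apply: lt_le_trans (_ : iter n (prev c') (prev c ((t + t') / 2)) <= _).
  by near: c'.
apply: iter_prev_le; apply: ltW; have := calibrated_prev c' t.
move: (prev c' t); near: c'; exact: near_1.
Unshelve. all: by end_near. Qed.

Lemma near_displacement c n t :
  \forall c' \near c, `|displacement c' n t - displacement c n t| < 1.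
Proof.
(* Translates of [t] by one unit turn the strict inequalities into an error below 1. *)
have tt : t < t + 1%:~R by rewrite ltrDl.
have tt' : t + (-1)%:~R < t by rewrite mulrN1z; lra.
have near_lt := near_iter_prev_lt c n tt.
have near_gt := near_iter_prev_gt c n tt'.
near=> c'; rewrite /displacement ltr_norml.
have : iter n (prev c') t < iter n (prev c) (t + 1%:~R) by near: c'.
have : iter n (prev c) (t + (-1)%:~R) < iter n (prev c') t by near: c'.
rewrite !iter_prev_int mulrN1z => *; apply/andP; split; lra.
Unshelve. all: by end_near. Qed.

(** * The derivative of [alpha] as a rotation number *)

(* The common rotation number of the calibrated backward orbits is trapped
   between the left and right slopes of [alpha], and varies continuously. *)
Lemma near_alpha_slope c n t : \forall s \near (0 : R)^',
  `|n%:R * (s^-1 * (alpha S (s + c) - alpha S c)) + displacement c n t| <= 2.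
Proof.
have near_d : \forall s \near (0 : R)^',
    `|displacement (s + c) n t - displacement c n t| < 1.
  apply: cvg_within; exact: (near_shift (near_displacement c n t)).
near=> s; have s0 : s != 0 by near: s; exact: nbhs_dnbhs_neq.
have : `|displacement (s + c) n t - displacement c n t| < 1 by near: s.
rewrite ltr_norml ler_norml => /andP[dl du].
pose q := s^-1 * (alpha S (s + c) - alpha S c).
have qE : alpha S (s + c) - alpha S c = s * q by rewrite /q mulVKf.
(* One unit of error comes from the slope bounds, another from replacing the class [s + c] by [c] in
   the displacement. *)
rewrite -/q; have [sgt0|slt0|s_eq0] := ltgtP 0 s; last by rewrite -s_eq0 eqxx in s0.
- have cs : c <= s + c by rewrite lerDr ltW.
  move: (displacement_slope_l n t cs) (displacement_slope_r n t cs).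
  rewrite qE addrK mulrCA -!mulrDr pmulr_rge0// pmulr_rle0// => *.
  by apply/andP; split; lra.
- have cs : s + c <= c by rewrite gerDr ltW.
  move: (displacement_slope_l n t cs) (displacement_slope_r n t cs).
  rewrite -[alpha S c - _]opprB qE (_ : c - (s + c) = - s); last by ring.
  rewrite -[- (s * q)]mulNr mulrCA -!mulrDr.
  have s'0 : 0 < - s by rewrite oppr_gt0.
  rewrite pmulr_rge0// pmulr_rle0// => *.
  by apply/andP; split; lra.
Unshelve. all: by end_near. Qed.

(** Near [c] all difference quotients are within [2 / n] of [- displacement c n 0 / n]: they satisfy
    the Cauchy criterion. *)
Lemma alpha_derivable c : derivable (alpha S) c 1.
Proof.
suff [l /is_derive_quotient dl] : exists l : R,
  (fun s => s^-1 * (alpha S (s + c) - alpha S c)) @ 0^' --> l.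
  by have [] := dl.
apply/cvg_ex/cauchy_cvgP/cauchy_exP => e e0.
pose n := (Num.bound (2 / e)).+1.
have n_large : 2 < n%:R * e.
  have := archi_boundP (divr_ge0 (ler0n _ 2) (ltW e0)).
  rewrite ltr_pdivrMr// => /lt_le_trans; apply.
  by apply: ler_wpM2r; [exact: ltW|rewrite ler_nat].
have n0 : 0 < n%:R :> R by rewrite ltr0n.
exists (- displacement c n 0 / n%:R).
apply: filterS (near_alpha_slope c n 0) => s /=.
rewrite -ball_normE /= => slope.
rewrite -(ltr_pM2l n0) -[X in X * `|_|]gtr0_norm// -normrM.
apply: le_lt_trans n_large; rewrite -normrN; apply: le_trans slope.
move: (s^-1 * _) => q; rewrite le_eqVlt; apply/orP; left; apply/eqP.
by congr `|_|; field; rewrite gt_eqF.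
Qed.

(** Limit of the slope estimate. The sign is a plus because [prev] runs backward in time. *)
Lemma displacement_rotation_number c n t :
  `|displacement c n t + n%:R * rotation_number S c| <= 2.
Proof.
have /is_derive_quotient lim_slope : is_derive c 1 (alpha S) (rotation_number S c).
  by rewrite /rotation_number derive1E; exact/derivableP/alpha_derivable.
have lim_norm : (fun s => `|displacement c n t +
    n%:R * (s^-1 * (alpha S (s + c) - alpha S c))|) @ 0^' -->
    `|displacement c n t + n%:R * rotation_number S c|.
  by apply: cvg_norm; apply: cvgD; [exact: cvg_cst|exact: cvgMr].
apply: cvgr_to_le lim_norm _.
by apply: filterS (near_alpha_slope c n t) => s; rewrite addrC.
Qed.

(* Two calibrated backward orbits of [q] can cross only at their ends. If the
   [c]-orbit started on the left, it would have to end up on the right of the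
   [c']-orbit, which has a larger rotation number. *)
Lemma calibrated_rotation c c' q y y' :
  rotation_number S c < rotation_number S c' ->
  calibrated c q y -> calibrated c' q y' -> y' < y.
Proof.
move=> rot qy qy'; rewrite ltNge; apply/negP => yy.
(* Backward orbits of [q] through the given [y] and [y'], which need not be the choices made by
   [prev]. *)
pose x n := if n is k.+1 then iter k (prev c) y else q.
pose x' n := if n is k.+1 then iter k (prev c') y' else q.
have calx n : calibrated c (x n) (x n.+1) by case: n => //= n; exact: calibrated_prev.
have calx' n : calibrated c' (x' n) (x' n.+1).
  by case: n => //= n; exact: calibrated_prev.
pose d := alpha S c' - alpha S c.
have gapx n : gap c c' q <= gap c c' (x n) + n%:R * d.
  elim: n => [|n]; first by rewrite mul0r addr0.
  by have := gap_calibrated_l c' (calx n); rewrite -/d -natr1; lra.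
have gapx' n m : gap c c' (x' (n + m)%N) + m%:R * d <= gap c c' (x' n).
  elim: m => [|m]; first by rewrite addn0 mul0r addr0.
  by have := gap_calibrated_r c (calx' (n + m)%N); rewrite -/d -natr1 addnS; lra.
have [n xn] : exists n, x' n.+1 < x n.+1.
  pose r := rotation_number S c' - rotation_number S c.
  have r0 : 0 < r by rewrite subr_gt0.
  (* Each displacement is known up to 2, whence the 4. *)
  exists (Num.bound ((y' - y + 4) / r)); rewrite /x /x'.
  set n := Num.bound _.
  have : (y' - y + 4) / r < n%:R by apply: archi_boundP; apply: divr_ge0; lra.
  rewrite ltr_pdivrMr//.
  move: (displacement_rotation_number c n y) (displacement_rotation_number c' n y').
  by rewrite /displacement !ler_norml /r => /andP[? ?] /andP[? ?]; lra.
have [k [kn kS]] : exists k, x k.+1 <= x' k.+1 /\ x' k.+2 < x k.+2.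
  elim: n xn => [|n IH] xn; first by rewrite ltNge yy in xn.
  by have [/IH//|xn'] := ltP (x' n.+1) (x n.+1); exists n.
(* Both orbits start at [q], so the two telescoped inequalities chain through [gap c c' q]. *)
have gapk : gap c c' (x' k.+1) <= gap c c' (x k.+1).
  by have := gapx k.+1; have := gapx' 0%N k.+1; rewrite add0n /=; lra.
move: kn; rewrite le_eqVlt => /predU1P[e|lt_x]; last first.
  by have := calibrated_crossing (calx k.+1) (calx' k.+1) lt_x kS; rewrite ltNge gapk.
(* If the orbits meet, the chain makes the last [c']-step calibrated for [c] as well; Euler-Lagrange
   then forces the next predecessors to agree. *)
have calk : calibrated c (x' k) (x' k.+1).
  have gapk' : gap c c' (x' k) <= gap c c' (x' k.+1) + d.
    have := gapx k.+1; have := gapx' 0%N k; rewrite add0n e -natr1 /=; lra.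
  move=> z; move: (u_le_cost c (x' k) z) (u_calibrated (calx' k)) gapk'.
  by rewrite /gap /d /cost; lra.
have /(congr1 (fun v => v - dtheta S (x' k.+1, x' k))) :
    dTheta S (x k.+2, x' k.+1) + dtheta S (x' k.+1, x' k) =
    dTheta S (x' k.+2, x' k.+1) + dtheta S (x' k.+1, x' k).
  rewrite (calibrated_euler_lagrange (calx' k) (calx' k.+1)).
  by apply: calibrated_euler_lagrange calk _; rewrite -e; exact: calx.
by rewrite !addrK => /(dTheta_inj S_generating) e'; rewrite e' ltxx in kS.
Qed.

(** * Reachable derivatives and calibrated points *)

Lemma is_derive_cost c t y :
  is_derive t 1 (fun s => cost c s y + alpha S c) (dTheta S (y, t) - c).
Proof.
have -> : (fun s => cost c s y + alpha S c) =
    (fun s => S (y, s)) + (fun s => - c * s + (u (y, c) + c * y + alpha S c)).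
  by apply/funext => s; rewrite fctE /cost; ring.
exact: is_deriveD (is_derive_dTheta S_generating y t) (is_derive_affine _ _ t).
Qed.

(** The cost of a calibrated point touches the solution from above at [t]. *)
Lemma derive1_calibrated c t y : derivable (fun s => u (s, c)) t 1 ->
  calibrated c t y -> derive1 (fun s => u (s, c)) t = dTheta S (y, t) - c.
Proof.
move=> /derivableP du cal; rewrite derive1E.
apply: derive_touching du (is_derive_cost c t y) _ _; first exact: u_calibrated.
by near=> s; exact: u_le_cost.
Unshelve. all: by end_near. Qed.

(* At an interior minimum of [u_c + C (s - m)^2] the graph of [u_c] is squeezed
   between a parabola and the cost of a calibrated point. *)
Lemma derivable_dense c a b : a < b ->
  exists2 t, a < t < b & derivable (fun s => u (s, c)) t 1.
Proof.
move=> ab; have [B uB] := u_bounded c.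
(* [C] makes the penalty [2 B + 1] at both ends, so [v] exceeds [B] there while [v m <= B]. *)
pose m := (a + b) / 2; pose C := (2 * B + 1) / (m - a) ^+ 2.
have ma : 0 < m - a by rewrite /m; lra.
have Cma : C * (m - a) ^+ 2 = 2 * B + 1.
  by rewrite /C divfK// gt_eqF// exprn_gt0.
have ucont : continuous (fun s => u (s, c)) by case: (u_weak_KAM c).
pose v s := u (s, c) + C * (s - m) ^+ 2.
have vcont : continuous v.
  move=> s; apply: cvgD; first exact: ucont.
  apply: cvgMr; rewrite /= expr2; under eq_fun do rewrite expr2.
  by apply: cvgM; apply: cvgB (cvg_id) (cvg_cst _).
have [t tab tmin] := EVT_min (ltW ab) (continuous_subspaceT vcont).
have vm : v t <= B.
  have m_in : m \in `[a, b] by rewrite in_itv/= /m; apply/andP; split; lra.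
  apply: le_trans (tmin _ m_in) _; rewrite /v subrr expr0n mulr0 addr0.
  exact: le_trans (ler_norm _) (uB m).
have v_end s : (s - m) ^+ 2 = (m - a) ^+ 2 -> B < v s.
  move=> sE; rewrite /v sE Cma; have := uB s.
  by rewrite ler_norml => /andP[+ _]; lra.
have t_in : a < t < b.
  move: tab; rewrite in_itv/= !le_eqVlt => /andP[/predU1P[ta|->]].
    have : B < v t by apply: v_end; rewrite -ta; ring.
    by rewrite ltNge vm.
  move=> /predU1P[tb|->//].
  have : B < v t by apply: v_end; rewrite tb /m; field.
  by rewrite ltNge vm.
exists t => //.
have [y cal] := calibrated_exists c t.
pose w := (fun s => C * (t - m) ^+ 2 + u (t, c) - C * (s - m) ^+ 2).
have dw : is_derive t 1 w (- (C * (2 * (t - m)))) by exact: is_derive_parabola.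
have w_le : \forall s \near t, w s <= u (s, c).
  have : \forall s \near t, s \in `]a, b[ by exact: near_in_itvoo.
  apply: filterS => s; rewrite in_itv/= => /andP[sa sb].
  have /tmin : s \in `[a, b] by rewrite in_itv/= !ltW.
  by rewrite /v /w; lra.
have w_t : w t = u (t, c) by rewrite /w addrAC subrr add0r.
have u_t := u_calibrated cal.
have dcost := is_derive_cost c t y.
have slope : - (C * (2 * (t - m))) = dTheta S (y, t) - c.
  apply: derive_touching dw dcost _ _; first by rewrite w_t.
  by apply: filterS w_le => s /le_trans; apply; exact: u_le_cost.
rewrite slope in dw.
have [] // := @derive_sandwich _ _ _ (fun s => u (s, c)) _ _ dw dcost w_t (esym u_t) _.
by apply: filterS w_le => s ->; exact: u_le_cost.
Qed.

(** Nearby derivatives come from calibrated points in a fixed compact interval, and being calibrated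
    with a prescribed slope is a closed condition. *)
Lemma closure_derivative_graph_calibrated c q p :
  closure (derivative_graph (fun s => u (s, c))) (q, p) ->
  exists2 y, calibrated c q y & c + p = dTheta S (y, q).
Proof.
move=> clp; apply: contrapT => none.
have [M bounded] := calibrated_bound `|c| q.
have near_none : \forall x \near (q, p), `[- M, M]%classic `<=`
    (fun y => ~ (calibrated c x.1 y /\ c + x.2 = dTheta S (y, x.1))).
  have cov := (compact_near_coveringP _).1 (@segment_compact R (- M) M).
  apply: (cov _ (nbhs (q, p)) (fun x y =>
    ~ (calibrated c x.1 y /\ c + x.2 = dTheta S (y, x.1)))) => y _.
  have c1 : {for (y, (q, p)), continuous (fun x : R * (R * R) => x.1)}.
    exact: cvg_fst.
  have c21 : {for (y, (q, p)), continuous (fun x : R * (R * R) => x.2.1)}.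
    by apply: continuous_comp; [exact: cvg_snd|exact: cvg_fst].
  have c22 : {for (y, (q, p)), continuous (fun x : R * (R * R) => x.2.2)}.
    by apply: continuous_comp; [exact: cvg_snd|exact: cvg_snd].
  have [cal|not_cal] := pselect (calibrated c q y).
    have dist0 : 0 < `|c + p - dTheta S (y, q)|.
      rewrite normr_gt0 subr_eq0; apply/eqP => e; apply: none.
      by exists y.
    have cont : {for (y, (q, p)), continuous (fun x : R * (R * R) =>
        `|c + x.2.2 - dTheta S (x.1, x.2.1)|)}.
      apply: cvg_norm; apply: cvgB; first by apply: cvgD; [exact: cvg_cst|].
      apply: (@continuous_comp _ _ _ (fun x : R * (R * R) => (x.1, x.2.1)) (dTheta S)).
        exact: cvg_pair c1 c21.
      exact: (dTheta_continuous S_generating).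
    have near_ne : \forall x \near (y, (q, p)), 0 < `|c + x.2.2 - dTheta S (x.1, x.2.1)|.
      exact: cvgr_gt cont _ dist0.
    apply: filterS near_ne => x /= + [_ e]; by rewrite e subrr normr0 ltxx.
  have cont : {for (y, (q, p)), continuous (fun x : R * (R * R) =>
      ((c, x.2.1), x.1))}.
    apply: (@cvg_pair _ _ _ _ (nbhs (c, q)) (nbhs y)); last exact: c1.
    exact: cvg_pair (@cvg_cst _ c _ (nbhs (y, (q, p))) _) c21.
  have near_nc : \forall x \near (y, (q, p)), ~ calibrated c x.2.1 x.1.
    exact: (cont _ (near_not_calibrated not_cal)).
  by apply: filterS near_nc => x /= + [].
have near_q : \forall x \near (q, p), `|x.1 - q| <= 1.
  have : (fun x : R * R => x.1) @ (q, p) --> q by exact: cvg_fst.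
  by move=> /cvgr_dist_le/(_ 1 ltr01); apply: filterS => x; rewrite distrC.
have [[t r] [[/= du rE] [none_tr tq]]] := clp _ (filterI near_none near_q).
have [y cal] := calibrated_exists c t.
apply: (none_tr y) => /=.
  by rewrite in_itv/= -ler_norml; exact: bounded (lexx _) tq cal.
by split=> //; rewrite rE (derive1_calibrated du cal) subrKC.
Qed.

(** Compactness of [K] provides a limit of the points [z], and [dTheta S] is continuous. *)
Lemma closure_derivative_graph_compact c q (K : set R) : compact K ->
  (forall e, 0 < e -> exists t z, [/\ `|t - q| < e,
     derivable (fun s => u (s, c)) t 1, calibrated c t z & K z]) ->
  exists2 z, K z &
    closure (derivative_graph (fun s => u (s, c))) (q, dTheta S (z, q) - c).
Proof.
move=> /compact_near_coveringP cov approx; apply: contrapT => none.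
have near_none : \forall t \near q, K `<=`
    (fun z => ~ derivative_graph (fun s => u (s, c)) (t, dTheta S (z, t) - c)).
  apply: (cov _ (nbhs q) (fun t z =>
    ~ derivative_graph (fun s => u (s, c)) (t, dTheta S (z, t) - c))) => z Kz.
  have /near_not_closure not_cl :
      ~ closure (derivative_graph (fun s => u (s, c))) (q, dTheta S (z, q) - c).
    by move=> cl; apply: none; exists z.
  have cont : {for (z, q), continuous (fun x : R * R => (x.2, dTheta S x - c))}.
    apply: (@cvg_pair _ _ _ _ (nbhs q) (nbhs (dTheta S (z, q) - c))).
      exact: cvg_snd.
    by apply: cvgB; [exact: (dTheta_continuous S_generating)|exact: cvg_cst].
  have near_ncl : \forall x \near (z, q),
      ~ derivative_graph (fun s => u (s, c)) (x.2, dTheta S x - c).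
    exact: (cont _ not_cl).
  by apply: filterS near_ncl => -[].
move: near_none => /nbhs_ballP[e /= e0 near_e].
have [t [z [te du cal Kz]]] := approx e e0.
apply: (near_e t _ z Kz) => /=; first by rewrite -ball_normE/= distrC.
by split=> //=; rewrite (derive1_calibrated du cal).
Qed.

(** Approach [q] from the right by points of differentiability: by monotonicity their calibrated
    points stay above [y]. *)
Lemma closure_derivative_graph_right c q y : calibrated c q y ->
  exists2 z, y <= z &
    closure (derivative_graph (fun s => u (s, c))) (q, dTheta S (z, q) - c).
Proof.
move=> cal; have [M bounded] := calibrated_bound `|c| q.
have [e e0|z] := @closure_derivative_graph_compact c q _ (@segment_compact _ y M).
  (* The cap 1 keeps [t] where [M] bounds the calibrated points. *)
  have [|t /andP[qt te] du] := @derivable_dense c q (q + Num.min e 1).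
    by rewrite ltrDl lt_min e0 ltr01.
  have : t - q < Num.min e 1 by rewrite ltrBlDl.
  rewrite lt_min => /andP[tqe tq1].
  have tqE : `|t - q| = t - q by rewrite ger0_norm// subr_ge0 ltW.
  have [z calz] := calibrated_exists c t.
  exists t, z; split => //; first by rewrite tqE.
  rewrite /= in_itv/= ltW ?(calibrated_lt qt cal calz)//=.
  by apply: le_trans (ler_norm _) (bounded _ _ _ (lexx _) _ calz); rewrite tqE ltW.
by rewrite /= in_itv/= => /andP[yz _]; exists z.
Qed.

Lemma closure_derivative_graph_left c q y : calibrated c q y ->
  exists2 z, z <= y &
    closure (derivative_graph (fun s => u (s, c))) (q, dTheta S (z, q) - c).
Proof.
move=> cal; have [M bounded] := calibrated_bound `|c| q.
have [e e0|z] := @closure_derivative_graph_compact c q _ (@segment_compact _ (- M) y).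
  have [|t /andP[te tq] du] := @derivable_dense c (q - Num.min e 1) q.
    by rewrite ltrBlDr ltrDl lt_min e0 ltr01.
  have : q - t < Num.min e 1 by rewrite ltrBlDl -ltrBlDr.
  rewrite lt_min => /andP[tqe tq1].
  have tqE : `|t - q| = q - t by rewrite distrC ger0_norm// subr_ge0 ltW.
  have [z calz] := calibrated_exists c t.
  exists t, z; split => //; first by rewrite tqE.
  rewrite /= in_itv/= (ltW (calibrated_lt tq calz cal)) andbT.
  have : `|z| <= M by apply: (bounded _ _ _ (lexx _) _ calz); rewrite tqE ltW.
  by rewrite ler_norml => /andP[].
by rewrite /= in_itv/= => /andP[_ yz]; exists z.
Qed.

(** * Sweeping the line of calibrated points, and the two claims *)

(** The competitor [y - 1] gives [c <= S (y, q + 1) - S (y, q)], and the right side decreases in [y]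
    by crossing. *)
Lemma calibrated_lt_large c q b y : S (b, q + 1) - S (b, q) < c ->
  calibrated c q y -> y < b.
Proof.
move=> c_large /(_ (y + (-1)%:~R)); rewrite /cost u_int => cal.
have shift := generating_shift S_generating (-1) y (q + 1).
rewrite mulrN1z addrK in shift; rewrite mulrN1z shift in cal.
rewrite ltNge le_eqVlt; apply/negP => /predU1P[by'|by'].
  by subst b; lra.
have q1 : q < q + 1 by rewrite ltrDl.
by have := generating_crossing S_generating by' q1; lra.
Qed.

Lemma calibrated_gt_small c q b y : c < S (b, q) - S (b, q - 1) ->
  calibrated c q y -> b < y.
Proof.
move=> c_small /(_ (y + 1%:~R)); rewrite /cost u_int => cal.
have shift := generating_shift S_generating 1 y (q - 1).
rewrite subrK in shift; rewrite shift in cal.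
rewrite ltNge le_eqVlt; apply/negP => /predU1P[by'|by'].
  by subst b; lra.
have q1 : q - 1 < q by rewrite ltrBlDl ltrDr.
by have := generating_crossing S_generating by' q1; lra.
Qed.

(* The set of calibrated points of [q] varies upper semicontinuously with [c] and
   sweeps the whole line, and the real line is connected. *)
Lemma calibrated_between q b : exists c y y',
  [/\ calibrated c q y, calibrated c q y' & y <= b <= y'].
Proof.
apply: contrapT => none.
(* Without such a [c], [A] and [B] are disjoint open sets covering the line; large [c] lie in [A],
   small ones in [B]. *)
pose A : set R := [set c | forall y, calibrated c q y -> y < b].
pose B : set R := [set c | forall y, calibrated c q y -> b < y].
have AB c : A c \/ B c.
  apply: contrapT => /not_orP[/existsNP[y' /not_implyP[cal' /negP]]].
  rewrite -leNgt => by' /existsNP[y /not_implyP[cal /negP]].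
  by rewrite -leNgt => yb; apply: none; exists c, y, y'; rewrite yb by'.
have A_notB c : A c -> ~ B c.
  move=> Ac Bc; have [y cal] := calibrated_exists c q.
  by have := lt_trans (Ac _ cal) (Bc _ cal); rewrite ltxx.
have oA : open A by rewrite openE => c Ac; exact: near_calibrated_lt.
have oB : open B by rewrite openE => c Bc; exact: near_calibrated_gt.
have AE : A = ~` B.
  by apply/seteqP; split=> c; [exact: A_notB|move=> nB; case: (AB c)].
have connR : connected [set: R] by apply/connected_intervalP.
have AT : A = [set: R].
  apply: connR; first by exists (S (b, q + 1) - S (b, q) + 1) => y;
    apply: calibrated_lt_large; rewrite ltrDl.
  - by exists A; rewrite ?setTI.
  - by exists A; rewrite ?setTI//; rewrite AE; exact: open_closedC.
have : A (S (b, q) - S (b, q - 1) - 1) by rewrite AT.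
by move=> /A_notB; apply => y; apply: calibrated_gt_small; rewrite ltrBlDr ltrDl.
Qed.

(** With [p = dTheta S (b, q)], calibrated points on both sides of [b] give reachable slopes on both
    sides of [p]; the left one gives the upper slope. *)
Lemma pseudographs_cover :
  \bigcup_c pseudograph c (fun t => u (t, c)) = [set: R * R].
Proof.
apply/seteqP; split=> // -[q p] _.
have [b bp] := dTheta_surj S_generating q p.
have [c [y [y' [cal cal' /andP[yb by']]]]] := calibrated_between q b.
have [z yz clz] := closure_derivative_graph_left cal.
have [z' yz' clz'] := closure_derivative_graph_right cal'.
exists c => //; apply: pseudograph_between clz' clz _.
rewrite !subrKC -bp; apply/andP; split; apply: (dTheta_nonincreasing S_generating).
  exact: le_trans by' yz'.
exact: le_trans yz yb.
Qed.

(** Strict half-line bounds reduce both hulls to reachable slopes, which are ordered oppositely to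
    their calibrated points. *)
Lemma pseudographs_ordered c c' q p p' :
  rotation_number S c < rotation_number S c' ->
  pseudograph c (fun t => u (t, c)) (q, p) ->
  pseudograph c' (fun t => u (t, c')) (q, p') -> p < p'.
Proof.
move=> rot pc pc'.
apply: pseudograph_lt pc => r /closure_derivative_graph_calibrated[y cal ->].
apply: pseudograph_gt pc' => r' /closure_derivative_graph_calibrated[y' cal' ->].
apply: (dTheta_decreasing S_generating); exact: calibrated_rotation rot cal cal'.
Qed.

End calibration.

Theorem theorem1p2 (R : realType) (F : R * R -> R * R) (S : R * R -> R)
    (u : R * R -> R)
    (F_twist : symplectic_twist_map F)
    (S_generating : generating_function F S)
    (u_periodic : periodic u (1, 0))
    (u_continuous : continuous u)
    (u_normalized : forall c : R, u (0, c) = 0)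
    (u_weak_KAM : forall c : R, weak_KAM_solution S c (fun theta => u (theta, c))) :
  \bigcup_c pseudograph c (fun theta => u (theta, c)) = [set: R * R] /\
  (forall c c' : R, rotation_number S c < rotation_number S c' ->
     forall q p p' : R,
       pseudograph c (fun theta => u (theta, c)) (q, p) ->
       pseudograph c' (fun theta => u (theta, c')) (q, p') ->
       p < p').

Proof.
split; first exact: pseudographs_cover S_generating u_periodic u_continuous u_weak_KAM.
move=> c c' rot q p p' pc pc'.
exact: pseudographs_ordered S_generating u_periodic u_continuous u_weak_KAM
  _ _ _ _ _ rot pc pc'.
Qed.
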